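(* Let $OABC$ be an extangential LEQ that is not a kite, with consecutive side lengths $a=OA$, $b=AB$, $c=BC$, $d=CO$, labelled so that its excircle lies outside the vertex $B$. Let $\Sigma,T$ be the associated quantities defined in the context. Then $\Sigma$ and $T$ are integers and one of the following holds: (a) $(\Sigma,T)=(9,18)$ or $(18,50)$; (b) $(\Sigma,T)=(5m^2,5m^2+5)$ for some integer $m$ for which there exist integers $n,Y,Z$ such that $m^2-10n^2=-1$ and $(5m^2-8)Y^2=5+8Z^2$; (c) $(\Sigma,T)=(m^2,m^2+1)$ for some integer $m$ for which there exist integers $n,Y,Z$ such that $m^2-2n^2=-1$ and $(m^2-8)Y^2=1+8Z^2$.
   Context: A quadrilateral $OABC$ is given by four points of the plane, no three colinear, such that the segments $OA,AB,BC,CO$ have no interior points of intersection; it may be convex or concave. The vertices are written in positive (counterclockwise) cyclic order and, if $OABC$ is concave, the labelling is such that the reflex angle is at $B$. A lattice equable quadrilateral (LEQ) is a quadrilateral whose vertices lie on $\mathbb Z^2$ and whose area equals its perimeter. A kite is a quadrilateral having one of its diagonals as an axis of symmetry. A quadrilateral is extangential if it has an excircle, i.e. a circle exterior to it that is tangent to the extensions of all four sides; equivalently, it has no pair of parallel sides and $|a-c|=|b-d|$. Relabelling if necessary, one supposes that the excircle lies outside the vertex $B$; then $a+b=c+d$ and $a>c$. (For concave extangential quadrilaterals the excircle lies outside the vertex with the reflex angle.) For an extangential LEQ $OABC$ define $$\Sigma=8\cdot\frac{ad+bc+2\delta\sqrt{abcd-4(a+b)^2}}{16+(a-c)^2},\qquad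 T=8(a+b)^2\cdot\frac{ab+cd+2\delta\sqrt{abcd-4(a+b)^2}}{16(a+b)^2+(a-c)^2(a-d)^2},$$ where $\delta=1$ if $B$ lies within the circumcircle of the triangle $OAC$, and $\delta=-1$ otherwise. *)

(* Defs.v *)
From HB Require Import structures.
From mathcomp Require Import all_boot all_order all_algebra.
From mathcomp Require Import boolp reals.

Set Implicit Arguments.
Unset Strict Implicit.
Unset Printing Implicit Defensive.

Import Order.TTheory GRing.Theory Num.Theory.
Local Open Scope ring_scope.

Definition point (R : realType) : Type := (R * R)%type.

Definition dist (R : realType) (P Q : point R) : R :=
  Num.sqrt ((Q.1 - P.1) ^+ 2 + (Q.2 - P.2) ^+ 2).

(* Twice the signed area of the triangle PQS: positive when S lies strictly to
   the left of the directed line PQ, zero when P, Q, S are collinear. *)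
Definition orient (R : realType) (P Q S : point R) : R :=
  (Q.1 - P.1) * (S.2 - P.2) - (Q.2 - P.2) * (S.1 - P.1).

Definition open_segment (R : realType) (P Q X : point R) : Prop :=
  exists t : R, 0 < t < 1 /\
    X = ((1 - t) * P.1 + t * Q.1, (1 - t) * P.2 + t * Q.2).

Definition closed_segment (R : realType) (P Q X : point R) : Prop :=
  exists t : R, 0 <= t <= 1 /\
    X = ((1 - t) * P.1 + t * Q.1, (1 - t) * P.2 + t * Q.2).

Definition interiors_disjoint (R : realType) (P Q P' Q' : point R) : Prop :=
  forall X : point R, ~ (open_segment P Q X /\ open_segment P' Q' X).

Definition quadrilateral (R : realType) (O A B C : point R) : Prop :=
  [/\ orient O A B != 0, orient O A C != 0,
      orient O B C != 0 & orient A B C != 0] /\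
  [/\ interiors_disjoint O A A B,
      interiors_disjoint A B B C,
      interiors_disjoint B C C O &
      interiors_disjoint C O O A] /\
  interiors_disjoint O A B C /\ interiors_disjoint A B C O.

Definition perimeter (R : realType) (O A B C : point R) : R :=
  dist O A + dist A B + dist B C + dist C O.

(* The shoelace formula: for a simple quadrilateral this is its area, counted
   positively exactly when O, A, B, C is the counterclockwise order. *)
Definition area (R : realType) (O A B C : point R) : R :=
  ((O.1 * A.2 - A.1 * O.2) + (A.1 * B.2 - B.1 * A.2)
   + (B.1 * C.2 - C.1 * B.2) + (C.1 * O.2 - O.1 * C.2)) / 2.

(* In a counterclockwise polygon, the interior angle at V, between its
   predecessor U and its successor W, is reflex when UVW is a right turn. *)
Definition reflex (R : realType) (U V W : point R) : Prop := orient U V W < 0.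

Definition concave (R : realType) (O A B C : point R) : Prop :=
  [\/ reflex C O A, reflex O A B, reflex A B C | reflex B C O].

Definition standard_labelling (R : realType) (O A B C : point R) : Prop :=
  0 < area O A B C /\ (concave O A B C -> reflex A B C).

Definition lattice_point (R : realType) (P : point R) : Prop :=
  exists x y : int, P = (x%:~R, y%:~R).

Definition LEQ (R : realType) (O A B C : point R) : Prop :=
  [/\ quadrilateral O A B C,
      standard_labelling O A B C,
      [/\ lattice_point O, lattice_point A,
          lattice_point B & lattice_point C] &
      area O A B C = perimeter O A B C].

Definition on_sides (R : realType) (O A B C X : point R) : Prop :=
  [\/ closed_segment O A X, closed_segment A B X,
      closed_segment B C X | closed_segment C O X].

(* The reflection of X in the line PQ (for P <> Q). *)
Definition reflection (R : realType) (P Q X : point R) : point R :=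
  let t := ((X.1 - P.1) * (Q.1 - P.1) + (X.2 - P.2) * (Q.2 - P.2))
           / ((Q.1 - P.1) ^+ 2 + (Q.2 - P.2) ^+ 2) in
  (2 * (P.1 + t * (Q.1 - P.1)) - X.1, 2 * (P.2 + t * (Q.2 - P.2)) - X.2).

Definition symmetry_axis (R : realType) (O A B C P Q : point R) : Prop :=
  forall X : point R,
    on_sides O A B C (reflection P Q X) <-> on_sides O A B C X.

Definition kite (R : realType) (O A B C : point R) : Prop :=
  symmetry_axis O A B C O B \/ symmetry_axis O A B C A C.

Definition in_triangle (R : realType) (P Q S X : point R) : Prop :=
  exists u v w : R, [/\ 0 <= u, 0 <= v, 0 <= w & u + v + w = 1] /\
    X = (u * P.1 + v * Q.1 + w * S.1, u * P.2 + v * Q.2 + w * S.2).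

(* The closed region bounded by the quadrilateral: in a standard labelling the
   diagonal OB lies inside and cuts it into the triangles OAB and OBC. *)
Definition region (R : realType) (O A B C X : point R) : Prop :=
  in_triangle O A B X \/ in_triangle O B C X.

(* The distance from K to the line PQ, namely |orient P Q K| / dist P Q, is r. *)
Definition tangent_line (R : realType) (K : point R) (r : R) (P Q : point R) :
    Prop :=
  `|orient P Q K| = r * dist P Q.

(* "Exterior" means that the open disc misses the closed region.  Tangency is to
   the lines through the sides: when the angle at B is reflex, the points of
   contact with AB and BC are on these sides themselves. *)
Definition excircle (R : realType) (O A B C K : point R) (r : R) : Prop :=
  [/\ 0 < r,
      [/\ tangent_line K r O A, tangent_line K r A B,
          tangent_line K r B C & tangent_line K r C O] &
      forall X : point R, region O A B C X -> r <= dist K X].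

(* The circle lies beyond both sides meeting at B; as it is tangent to the lines
   AB and BC, it is on the same side of each of them as its centre K. *)
Definition outside_vertex_B (R : realType) (A B C K : point R) : Prop :=
  orient A B K < 0 /\ orient B C K < 0.

Definition within_circumcircle (R : realType) (P Q S X : point R) : Prop :=
  exists K : point R,
    [/\ dist K P = dist K Q, dist K Q = dist K S & dist K X < dist K P].

Definition delta (R : realType) (O A B C : point R) : R :=
  if `[< within_circumcircle O A C B >] then 1 else -1.

Definition Sigma (R : realType) (O A B C : point R) : R :=
  let a := dist O A in let b := dist A B in
  let c := dist B C in let d := dist C O in
  8 * ((a * d + b * c
        + 2 * delta O A B C * Num.sqrt (a * b * c * d - 4 * (a + b) ^+ 2))
       / (16 + (a - c) ^+ 2)).

Definition Tau (R : realType) (O A B C : point R) : R :=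
  let a := dist O A in let b := dist A B in
  let c := dist B C in let d := dist C O in
  8 * (a + b) ^+ 2
  * ((a * b + c * d
      + 2 * delta O A B C * Num.sqrt (a * b * c * d - 4 * (a + b) ^+ 2))
     / (16 * (a + b) ^+ 2 + (a - c) ^+ 2 * (a - d) ^+ 2)).

(* Main.v *)
(* Computing twice the area from the centre K of the excircle and comparing
   tangent lengths gives a + b = c + d =: s and e := a - c > 0; equability then
   makes all side lengths integers.  With m = ad(1 - cos O) and t = ab(1 + cos A)
   one gets |AC|^2 = (a - d)^2 + 2m and |OB|^2 = s^2 - 2t, so both are integers,
   and the half-angle formulas show that m = Sigma and t = Tau, the sign of the
   square root being that of cos((A + C)/2), hence delta.  Writing f = a - d,
   which is nonzero when there is no kite, and D = T - S, the sides satisfy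
       8 s^2 D = e^2 S T,    8 D f^2 = S (e^2 (S - 8) - 16 D),
   and |f| D < e S because the angles at A and C are not reflex.  If D <= 8,
   then 2 S T D is a square, and a case analysis on D leaves D = 1 and D = 5 with
   their Pell equations.  If D > 8, put x = S - 8 and y = D - 8: xy = 64 would
   make A, B, C collinear, xy < 64 is a finite check, and for xy > 64 the
   inequality on f bounds ef(xy - 64) by 16 D S, which leaves finitely many
   cases. *)
Require Import Defs.
From mathcomp Require Import all_boot all_order all_algebra.
From mathcomp Require Import boolp reals.
From Stdlib Require Import ZArith Lia.
From mathcomp Require Import zify ssrZ ring lra.

Set Implicit Arguments.
Unset Strict Implicit.
Unset Printing Implicit Defensive.

(** * Arithmetic of the pair (Sigma, Tau) *)

Section Integers.
Local Open Scope Z_scope.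

(** * Divisibility and integer squares *)

Lemma euclid (m x : Z) : 0 < m -> exists q r, x = m * q + r /\ 0 <= r < m.
Proof.
by move=> m0; exists (x / m), (x mod m); split;
  [apply: Z.div_mod; lia | apply: Z.mod_pos_bound].
Qed.

(* Descent: if 4k + 3 divides F^2 + 1, then F can be taken even and smaller than
   4k + 3 in absolute value, and the cofactor is again 3 modulo 4. *)
Lemma no_div_sqr_add_1 (k F : Z) : 0 <= k -> ~ (4 * k + 3 | F * F + 1).
Proof.
move=> k0; move: k k0 F; apply: Zlt_0_ind => k IH k0 F [t Ht].
have [G [u [HG Gk]]] : exists G u, 4 * (G * G) + 1 = u * (4 * k + 3)
    /\ - (4 * k + 3) < 2 * G < 4 * k + 3.
  have [q [r [Er Hr]]] := @euclid (4 * k + 3) F ltac:(lia).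
  have [p [i [Ei Hi]]] := @euclid 2 r ltac:(lia).
  have [? | ?] : i = 0 \/ i = 1 by lia.
    by exists p, (t - (4 * k + 3) * q * q - 2 * q * r); split; [nia | lia].
  exists (p - 2 * k - 1), (t - (4 * k + 3) * q * q - 2 * q * r - 2 * r + (4 * k + 3)).
  by split; [nia | lia].
have u0 : 0 < u < 4 * k + 3 by nia.
have [p [i [Ei Hi]]] := @euclid 4 u ltac:(lia).
have ? : i = 3 by nia.
apply: (IH p _ (2 * G)); first lia.
by exists (4 * k + 3); lia.
Qed.

Lemma gcd_cofactors (x y : Z) : x <> 0 ->
  exists g x' y', [/\ 0 < g, x = x' * g, y = y' * g & Z.gcd x' y' = 1].
Proof.
move=> x0; have g0 : Z.gcd x y <> 0 by move/Z.gcd_eq_0_l.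
have [x' Ex] := Z.gcd_divide_l x y; have [y' Ey] := Z.gcd_divide_r x y.
exists (Z.gcd x y), x', y'; split => //; first by have := Z.gcd_nonneg x y; lia.
have := Z.gcd_div_gcd x y (Z.gcd x y) g0 erefl.
by rewrite [X in X / _]Ex [X in _ (X / _)]Ey !Z.div_mul.
Qed.

Lemma sqr_div_sqr (e P X : Z) : e <> 0 -> P * P = e * e * X -> (e | P).
Proof.
move=> e0 H.
have [g [e' [P' [g0 Ee EP cop]]]] := @gcd_cofactors e P e0.
have H' : P' * P' = e' * e' * X.
  by subst; apply: (Z.mul_reg_l _ _ (g * g)); lia.
have d1 : (e' | P' * P') by exists (e' * X); lia.
have /Z.gauss := d1 => /(_ cop) d2.
by rewrite Ee EP; apply: Z.mul_divide_mono_r.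
Qed.

(** A rational square root of an integer is an integer; this cancels square factors from the
    equation for [f]. *)
Lemma sqr_quotient (e P X : Z) :
  e <> 0 -> P * P = e * e * X -> exists z, P = e * z /\ z * z = X.
Proof.
move=> e0 H; have [z Hz] := sqr_div_sqr e0 H.
by exists z; split; [lia | subst; nia].
Qed.

(** With g = gcd(x, z), the cofactor x / g is coprime to z / g and therefore divides g, while g is
    coprime to [y] and therefore divides x / g. So x = g^2. *)
Lemma coprime_mul_sqr (x y z : Z) :
  0 < x -> 0 < y -> Z.gcd x y = 1 -> x * y = z * z ->
  exists u v, x = u * u /\ y = v * v.
Proof.
have half a b : 0 < a -> 0 < b -> Z.gcd a b = 1 -> a * b = z * z ->
    exists u, a = u * u.
  move=> a0 b0 cop H.
  have [g [a' [z' [g0 Ea Ez cop']]]] := @gcd_cofactors a z ltac:(lia).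
  have H' : a' * b = g * (z' * z').
    by subst; apply: (Z.mul_reg_l _ _ g); lia.
  have d1 : (a' | g).
    apply: (Z.gauss _ z' _ _ cop'); apply: (Z.gauss _ z' _ _ cop').
    by exists b; lia.
  have gb : Z.gcd g b = 1.
    apply: Z.divide_1_r_nonneg; first exact: Z.gcd_nonneg.
    rewrite -cop; apply: Z.gcd_greatest; last exact: Z.gcd_divide_r.
    by rewrite Ea; apply: Z.divide_trans (Z.gcd_divide_l _ _) _; exists a'.
  have d2 : (g | a').
    by apply: (Z.gauss _ b _ _ gb); exists (z' * z'); lia.
  have a0' : 0 < a' by nia.
  have -> : a = a' * a'.
    rewrite {1}Ea; congr (_ * _); apply: Z.divide_antisym_nonneg => //; lia.
  by exists a'.
move=> x0 y0 cop H.
have [u ->] := half x y x0 y0 cop H.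
have [v ->] : exists v, y = v * v by apply: (half y x); rewrite // 1?Z.gcd_comm //; lia.
by exists u, v.
Qed.

Lemma gcd_lincomb (x y p q : Z) : p * x + q * y = 1 -> Z.gcd x y = 1.
Proof.
by move=> H; apply/Z.bezout_1_gcd; exists p, q.
Qed.

(** * Residue arguments, and the gaps D = T - S up to 8 *)

Ltac split_range r :=
  match goal with
  | H : (0 <= r < ?b) |- _ =>
      let b' := eval compute in (b - 1) in
      lazymatch b' with
      | 0 => assert (r = 0) by lia; subst r; clear H
      | _ => assert (r = b' \/ 0 <= r < b') as [? | ?] by lia; clear H;
             [subst r | split_range r]
      end
  end.

(** A residue is discarded when [lia], with nonlinear monomials as atoms, refutes it after
    substitution; if none survives, the goal is proved. *)
Ltac residues x m :=
  let q := fresh "q" in let r := fresh "r" in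
  destruct (@euclid m x ltac:(lia)) as (q & r & ? & ?); subst x;
  split_range r; try (exfalso; lia).

(* Proves x = m * y + i by refuting the other residues of x modulo m. *)
Ltac residue x m i y :=
  let H := fresh in
  assert (exists y, x = m * y + i) as [y H] by (residues x m; eexists; reflexivity);
  subst x.

Ltac parity x k :=
  let H := fresh in
  assert (exists k, x = 2 * k \/ x = 2 * k + 1) as [k [H | H]]
    by (destruct (@euclid 2 x ltac:(lia)) as (q & r & ? & ?); exists q; lia);
  subst x.

(* From x * y = w^2 and the Bezout relation p * x + q * y = 1, splits x = u^2 and
   y = v^2. *)
Ltac split_sqr x y p q w u v :=
  let Hu := fresh in let Hv := fresh in
  destruct (@coprime_mul_sqr x y w ltac:(lia) ltac:(lia)
    ltac:(apply: (@gcd_lincomb x y p q); lia) ltac:(lia)) as (u & v & Hu & Hv).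

(* The lemmas gap1 to gap8 treat D = T - S = 1, ..., 8; z^2 = 2 S T D comes from
   8 s^2 D = e^2 S T. *)
Lemma gap1 (S e f z : Z) : 8 < S ->
  z * z = 2 * S * (S + 1) * 1 ->
  8 * 1 * (f * f) = S * (e * e * (S - 8) - 16 * 1) ->
  exists m n Y Z, [/\ S = m * m, m * m - 2 * (n * n) = -1
   & (m * m - 8) * (Y * Y) = 1 + 8 * (Z * Z)].
Proof.
move=> S8 Sq Ef.
residue z 2 0 w.
parity S k.
(* Here S = 2 n^2 and S + 1 = m^2, and the equation for [f] becomes 2 F'^2 + 2 = e^2 (n'^2 - 1): an
   even [n'] gives a divisor of F'^2 + 1 that is 3 modulo 4, an odd one gives F'^2 = -1 modulo 4. *)
- exfalso; subst; split_sqr k (2 * k + 1) (-2) 1 w n m; subst k.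
  residue m 2 1 m'; residue n 2 0 n'.
  have [F [Ff HF]] : exists F, f = (2 * n') * F /\ F * F = 2 * (e * e * (n' * n' - 1) - 2).
    by apply: sqr_quotient; nia.
  residue F 2 0 F'.
  parity n' k.
  + residue e 2 0 e'.
    apply: (@no_div_sqr_add_1 (k * k - 1) F'); first nia.
    by exists (2 * (e' * e')); lia.
  + residues F' 2; residues k 2.
(* S = m^2 and S + 1 = 2 n^2 give the Pell equation; powers of 2 then force e = 4 Y and f = 4 m Z
   with [Y] odd. *)
- split_sqr (2 * k + 1) (k + 1) (-1) 2 w m n; have ? : k = n * n - 1 by lia.
  have [F [Ff HF]] : exists F, 4 * f = m * F /\ F * F = 2 * (e * e * (m * m - 8) - 16).
    by apply: sqr_quotient; nia.
  residue m 2 1 m'; residue F 4 0 F'; residue e 4 0 e'; residue F' 2 0 F''.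
  residue e' 2 1 y.
  have [t ?] : exists t, F'' = 2 * t.
    by parity F'' t; [exists t | residues m' 2; residues y 2].
  subst.
  exists (2 * m' + 1), n, (2 * y + 1), t; split; lia.
Qed.

Lemma gap5 (S e f z : Z) : 8 < S ->
  z * z = 2 * S * (S + 5) * 5 ->
  8 * 5 * (f * f) = S * (e * e * (S - 8) - 16 * 5) ->
  exists m n Y Z, [/\ S = 5 * (m * m), m * m - 10 * (n * n) = -1
   & (5 * (m * m) - 8) * (Y * Y) = 5 + 8 * (Z * Z)].
Proof.
move=> S8 Sq Ef.
residue z 5 0 z'; residue S 5 0 k; residue z' 10 0 w.
have kw : k * (k + 1) = 10 * (w * w) by lia.
(* As [k] and [k + 1] are coprime, the factor 10 can be shared out in four ways. Only 10 dividing
   [k + 1] survives: 10 dividing [k] fails as the even case did for D = 1, and the mixed cases make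
   2 or 3 a square modulo 5. *)
have [l [El | [El | [El | El]]]] : exists l,
    k + 1 = 10 * l \/ k = 10 * l \/ k = 10 * l + 4 \/ k = 10 * l + 5.
  by residues k 10; [exists (q + 1) | exists q | exists q | exists q]; lia.
- split_sqr k l (-1) 10 w m n; subst k l.
  have [F [Ff HF]] : exists F, 4 * f = m * F /\ F * F = 2 * (e * e * (5 * (m * m) - 8) - 80).
    by apply: sqr_quotient; [move=> ?; subst; lia | lia].
  residue m 2 1 m'; residue F 4 0 F'; residue e 4 0 e'; residue F' 2 0 F''.
  residue e' 2 1 y.
  have [t ?] : exists t, F'' = 2 * t.
    by parity F'' t; [exists t | residues m' 2; residues y 2].
  by subst; exists (2 * m' + 1), n, (2 * y + 1), t; split; lia.
- exfalso; subst k; split_sqr l (10 * l + 1) (-10) 1 w n m; subst l.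
  residue m 2 1 m'; residue n 2 0 n'.
  have [F [Ff HF]] : exists F,
      f = (10 * n') * F /\ 5 * (F * F) = e * e * (25 * (n' * n') - 1) * 2 - 20.
    have [F [Ff HF]] : exists F,
        f = (2 * n') * F /\ F * F = 5 * (e * e * (25 * (n' * n') - 1) * 2 - 20).
      by apply: sqr_quotient; [move=> ?; (have ? : n' = 0 by lia); subst; lia | lia].
    residue F 5 0 F'; exists F'; lia.
  residue F 2 0 F'; parity n' k.
  + residue e 10 0 e'.
    apply: (@no_div_sqr_add_1 (25 * (k * k) - 1) F'); first by clear -S8; nia.
    by exists (10 * (e' * e')); lia.
  + residues F' 2; residues k 2.
- subst k; split_sqr (2 * l + 1) (5 * l + 2) 5 (-2) w m n.
  residues n 5.
- subst k; split_sqr (2 * l + 1) (5 * l + 3) (-5) 2 w m n.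
  residues n 5.
Qed.

Lemma gap2 (S z : Z) : 8 < S -> z * z = 2 * S * (S + 2) * 2 -> False.
Proof.
move=> S8 Sq; residue z 2 0 w.
(* w^2 = (S + 1)^2 - 1. *)
have ? : S < Z.abs w < S + 1 by nia.
lia.
Qed.

Lemma gap8 (S z : Z) : 8 < S -> z * z = 2 * S * (S + 8) * 8 -> False.
Proof.
move=> S8 Sq; residue z 4 0 w.
(* w^2 = (S + 4)^2 - 16. *)
have ? : S + 3 < Z.abs w < S + 4 by nia.
lia.
Qed.

Lemma gap3 (S e f z : Z) : 8 < S ->
  z * z = 2 * S * (S + 3) * 3 ->
  8 * 3 * (f * f) = S * (e * e * (S - 8) - 16 * 3) -> False.
Proof.
move=> S8 Sq Ef.
residue z 3 0 z'; residue S 3 0 k; residue z' 6 0 w.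
have kw : k * (k + 1) = 6 * (w * w) by lia.
(* The first and last cases contradict the squares modulo 3; the second contradicts the equation for
   [f] modulo powers of 3, the third modulo powers of 2. *)
have [l [El | [El | [El | El]]]] : exists l,
    k + 1 = 6 * l \/ k = 6 * l \/ k = 6 * l + 2 \/ k = 6 * l + 3.
  by residues k 6; [exists (q + 1) | exists q | exists q | exists q]; lia.
- split_sqr k l (-1) 6 w m n; subst k; residues m 3.
- subst k; split_sqr l (6 * l + 1) (-6) 1 w u v; subst l.
  have [F [Ff HF]] : exists F, 2 * f = u * F /\ F * F = 6 * (e * e * (9 * (u * u) - 4) - 24).
    by apply: sqr_quotient; [move=> ?; subst; lia | lia].
  residue F 3 0 F'; residue e 3 0 e'; residues F' 3.
- rewrite {}El in kw Ef S8; split_sqr (3 * l + 1) (2 * l + 1) (-2) 3 w u v.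
  have El : 3 * (6 * l + 2) = 6 * (u * u) by lia.
  rewrite {}El in Ef.
  have [F [Ff HF]] : exists F, 2 * f = u * F /\ F * F = 2 * (e * e * (3 * (u * u) - 4) - 24).
    by apply: sqr_quotient; [move=> ?; subst; lia | lia].
  residue v 2 1 v'; residue u 2 1 u'.
  residue F 2 0 F'; residue e 2 0 e'; residue F' 2 0 F''; residue e' 2 0 e''.
  residue F'' 2 1 G; residues u' 2; residues G 2; residues e'' 2.
- subst k; split_sqr (2 * l + 1) (3 * l + 2) (-3) 2 w u v.
  residues v 3.
Qed.

Lemma gap4 (S e f z : Z) : 8 < S ->
  z * z = 2 * S * (S + 4) * 4 ->
  8 * 4 * (f * f) = S * (e * e * (S - 8) - 16 * 4) -> False.
Proof.
move=> S8 Sq Ef.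
residue z 4 0 z'; residue S 2 0 k; residue z' 2 0 w; residue k 2 0 l; residue w 2 0 w'.
have kw : l * (l + 1) = 2 * (w' * w') by lia.
(* S = 4 l, and [l] splits as [S] did for D = 1: the even case ends in the descent, the odd one in a
   contradiction modulo powers of 2. *)
parity l k.
- split_sqr k (2 * k + 1) (-2) 1 w' n m; subst k.
  have [F [Ff HF]] : exists F, f = n * F /\ F * F = 2 * (e * e * (n * n - 1) - 8).
    by apply: sqr_quotient; [move=> ?; subst; lia | lia].
  residue m 2 1 m'; residue n 2 0 n'.
  residue F 2 0 F'; residue e 2 0 e'; residue F' 2 0 F''; residue e' 2 0 e''.
  apply: (@no_div_sqr_add_1 (n' * n' - 1) F''); first by clear -S8; nia.
  by exists (2 * (e'' * e'')); lia.
- split_sqr (2 * k + 1) (k + 1) (-1) 2 w' m n.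
  have Ek : 4 * (2 * k + 1) = 4 * (m * m) by lia.
  have [F [Ff HF]] : exists F, 2 * f = m * F /\ F * F = 2 * (e * e * (m * m - 2) - 16).
    apply: sqr_quotient; [move=> ?; subst; lia | ].
    have Ef' : 8 * 4 * (f * f) = 4 * (m * m) * (e * e * (4 * (m * m) - 8) - 16 * 4).
      by rewrite -Ek; lia.
    by lia.
  residue m 2 1 m'; residue F 2 0 F'; residue e 2 0 e'.
  residue F' 2 0 F''; residue e' 2 0 e''; residue F'' 2 0 G; residue e'' 2 1 y.
  residues m' 2; residues y 2; residues G 2.
Qed.

Lemma gap6 (S e f z : Z) : 8 < S ->
  z * z = 2 * S * (S + 6) * 6 ->
  8 * 6 * (f * f) = S * (e * e * (S - 8) - 16 * 6) -> False.
Proof.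
move=> S8 Sq Ef.
residue z 6 0 z'; residue S 3 0 k; residue z' 3 0 w.
have kw : k * (k + 2) = 3 * (w * w) by lia.
(* In each parity, one of the alternatives 3 | k and 3 | k + 2 is refuted by the squares modulo 3,
   the other by the equation for [f]. *)
parity k l.
- residue w 2 0 w'; residues l 3.
  + split_sqr (3 * q + 2) (q + 1) (-1) 3 w' u v; residues u 3.
  + split_sqr q (3 * q + 1) (-3) 1 w' u v; subst q.
    have [F [Ff HF]] : exists F, 2 * f = u * F /\ F * F = 3 * (e * e * (9 * (u * u) - 4) - 48).
      by apply: sqr_quotient; [move=> ?; subst; lia | lia].
    residue F 3 0 F'; residue e 3 0 e'; residues F' 3.
- have [l' [El | El]] : exists l', 2 * l + 3 = 3 * l' \/ 2 * l + 1 = 3 * l'.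
    by residues l 3; [exists (2 * q + 1); right | exists (2 * q + 1); left]; lia.
  + parity l' i; first lia.
    have ? : l = 3 * i by lia.
    subst l; split_sqr (6 * i + 1) (2 * i + 1) i (1 - 3 * i) w u v.
    have [F [Ff HF]] : exists F, 4 * f = u * F /\ F * F = e * e * (3 * (u * u) - 8) - 96.
      apply: sqr_quotient; [move=> ?; subst; lia | ].
      have Ek : 3 * (2 * (3 * i) + 1) = 3 * (u * u) by lia.
      have Ef' : 8 * 6 * (f * f) = 3 * (u * u) * (e * e * (3 * (u * u) - 8) - 16 * 6).
        by rewrite -Ek; lia.
      by lia.
    residue u 2 1 u'; residue F 4 0 F'; residue e 4 0 e'.
    residues u' 2; residues F' 4; residues e' 4.
  + parity l' i; first lia.
    have ? : l = 3 * i + 1 by lia.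
    subst l; split_sqr (2 * i + 1) (6 * i + 5) (3 * i + 1) (- i) w u v.
    residues v 3.
Qed.

Lemma gap7 (S e f z : Z) : 8 < S ->
  z * z = 2 * S * (S + 7) * 7 ->
  8 * 7 * (f * f) = S * (e * e * (S - 8) - 16 * 7) -> False.
Proof.
move=> S8 Sq Ef.
residue z 7 0 z'; residue S 7 0 k; residue z' 14 0 w.
have kw : k * (k + 1) = 14 * (w * w) by lia.
(* The surviving residues are 13, 7, 6 and 0. For 13 and 6, -1 or 3 would be a square modulo 7; for
   7 and 0 the equation for [f] forces 7 | e and then makes 3 or 6 a square modulo 7. *)
residues k 14.
- split_sqr (14 * q + 13) (q + 1) (-1) 14 w u v; residues u 7.
- split_sqr (2 * q + 1) (7 * q + 4) (-7) 2 w u v.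
  have Ek : 7 * (14 * q + 7) = 49 * (u * u) by lia.
  have Ef' : 8 * 7 * (f * f) = 49 * (u * u) * (e * e * (49 * (u * u) - 8) - 16 * 7).
    by rewrite -Ek; lia.
  have [F [Ff HF]] : exists F,
      4 * f = u * F /\ F * F = 14 * (e * e * (49 * (u * u) - 8) - 112).
    by apply: sqr_quotient; [move=> ?; subst; lia | lia].
  residue F 7 0 F'; residue e 7 0 e'; residues F' 7.
- split_sqr (7 * q + 3) (2 * q + 1) (-2) 7 w u v; residues u 7.
- split_sqr q (14 * q + 1) (-14) 1 w u v; subst q.
  have [F [Ff HF]] : exists F,
      4 * f = u * F /\ F * F = 28 * (e * e * (98 * (u * u) - 8) - 112).
    by apply: sqr_quotient; [move=> ?; subst; lia | lia].
  residue F 7 0 F'; residue e 7 0 e'; residues F' 7.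
Qed.

(** * The finite checks for D > 8 *)

Fixpoint all_from (n : nat) (i : Z) (P : Z -> bool) : bool :=
  if n is n'.+1 then P i && all_from n' (i + 1) P else true.

Definition all_upto (n : Z) (P : Z -> bool) : bool := all_from (Z.to_nat n) 1 P.

Lemma all_uptoP (n j : Z) (P : Z -> bool) :
  all_upto n P -> 1 <= j <= n -> P j.
Proof.
rewrite /all_upto => H Hj.
have {Hj} : 1 <= j < 1 + Z.of_nat (Z.to_nat n) by lia.
elim: (Z.to_nat n) (1) H => [|k IH] i /=; first by lia.
case/andP=> Pi /IH Hk Hj; have [<- // | ?] : i = j \/ i + 1 <= j by lia.
by apply: Hk; lia.
Qed.

Definition is_square (n : Z) : bool := let r := Z.sqrt n in r * r =? n.

Lemma is_squareP (n z : Z) : z * z = n -> is_square n.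
Proof.
move=> <-; rewrite /is_square; apply/Z.eqb_eq.
by rewrite -(Z.abs_square z) Z.sqrt_square; lia.
Qed.

(* check_e decides, for given S = x + 8 and D = y + 8, whether the equation
   8 D f^2 = S (e^2 (S - 8) - 16 D) has a solution f for this e.  In check_triple
   the variable q is e^2 (f^2 + 16) - 2 (e^2 S - 16 D): it satisfies
   q (2 S + f^2) = e^2 f^2 (f^2 + 16), so e, f and q determine S and D. *)
Definition check_e (x y e : Z) : bool :=
  let S := x + 8 in let D := y + 8 in
  let v := S * (e * e * x - 16 * D) in
  if [&& 0 <? v, v mod (8 * D) =? 0 & is_square (v / (8 * D))]
  then (S =? 18) && (D =? 32) else true.

(** For x y > 64 the range of [e] comes from e^2 (x y - 64) < 16 D^2. The value x y = 64 passes
    because it is excluded by a hypothesis of [sporadic]. *)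
Definition check_pair (x y : Z) : bool :=
  let S := x + 8 in let D := y + 8 in
  if is_square (2 * S * (S + D) * D) then
    if x * y <? 64 then (x =? 1) && (y =? 1) else
    if x * y =? 64 then true else
      all_upto (Z.sqrt (16 * (D * D) / (x * y - 64))) (check_e x y)
  else true.

Definition check_triple (e f q : Z) : bool :=
  let N := e * e * (f * f) * (f * f + 16) in
  if N mod q =? 0 then
    let S2 := N / q - f * f in
    let D32 := e * e * (S2 - f * f - 16) + q in
    let S := S2 / 2 in let D := D32 / 32 in
    ~~ [&& S2 mod 2 =? 0, D32 mod 32 =? 0, 30 <=? D - 8, D * f <? e * S,
     is_square (2 * S * (S + D) * D) & (e * e * S * (S + D)) mod (8 * D) =? 0]
  else true.

(** The range of [y] is x y < 64 + 16 S^2. Both orders are tested since either variable may be the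
    small one, and x y < 64 + 16 D^2 holds as well. *)
Lemma small_checked :
  all_upto 29 (fun x => all_upto ((64 + 16 * ((x + 8) * (x + 8))) / x)
    (fun y => check_pair x y && check_pair y x)).
Proof. by vm_compute. Qed.

(** Here x, y >= 30, which gives e f <= 27 and S >= 38; the cofactor 2 S + f^2 of [q] is then at
    least 76 + f^2. *)
Lemma large_checked :
  all_upto 27 (fun e => all_upto (27 / e) (fun f =>
    all_upto (e * e * (f * f) * (f * f + 16) / (76 + f * f))
      (check_triple e f))).
Proof. by vm_compute. Qed.

Lemma finite_range (x y : Z) : 1 <= x < 30 -> 1 <= y ->
  x * y < 64 + 16 * ((x + 8) * (x + 8)) -> check_pair x y /\ check_pair y x.
Proof.
move=> x30 y1 xy; apply/andP.
have H := all_uptoP small_checked (ltac:(lia) : 1 <= x <= 29).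
apply: (@all_uptoP _ y _ H).
by split => //; apply: Z.div_le_lower_bound; lia.
Qed.

Lemma sqr_lt (a b : Z) : 0 <= b -> a * a < b * b -> a < b.
Proof. nia. Qed.

Lemma sporadic (S D x y e f s z : Z) :
  S = x + 8 -> D = y + 8 -> 1 <= x -> 1 <= y -> x * y <> 64 -> 0 < e -> 0 < f ->
  z * z = 2 * S * (S + D) * D ->
  8 * D * (f * f) = S * (e * e * x - 16 * D) ->
  8 * D * (s * s) = e * e * S * (S + D) ->
  D * f < e * S ->
  (S = 9 /\ D = 9) \/ (S = 18 /\ D = 32).
Proof.
move=> ES ED x1 y1 xy64 e0 f0 Sq Ef Es Df.
have D0 : 0 < D by lia.
have S0 : 0 < S by lia.
have f1 : 1 <= f * f by clear -f0; nia.
have S1 : 1 <= S * S by clear -S0; nia.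
have D1 : 1 <= D * D by clear -D0; nia.
have e1 : 1 <= e * e by clear -e0; nia.
have DfeS : D * D * (f * f) < e * e * (S * S).
  by have := Z.mul_lt_mono_nonneg (D * f) (e * S) (D * f) (e * S); lia.
(* The squared inequality D f < e S yields [eb] when [f] is eliminated by [Ef]; a second use of [Ef]
   turns this into [fb]. *)
have xyE : x * y - 64 = x * D - 8 * S by lia.
have eb : e * e * (x * y - 64) < 16 * (D * D).
  apply: (Zmult_lt_reg_r _ _ S) => //; rewrite xyE.
  have : D * (8 * D * (f * f)) = D * (S * (e * e * x - 16 * D)) by rewrite Ef.
  by lia.
have fb : f * f * (x * y - 64) < 16 * (S * S).
  have [? | xy] : x * y <= 64 \/ 64 < x * y by lia.
    by have := Z.mul_nonneg_nonpos (f * f) (x * y - 64); lia.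
  have H := Zmult_lt_compat_r _ _ x ltac:(lia) eb.
  have H2 : 8 * D * (f * f) * (x * y - 64) = S * ((e * e * x - 16 * D) * (x * y - 64)).
    by rewrite Ef; lia.
  have H3 : (e * e * x - 16 * D) * (x * y - 64) < 128 * (D * S) by rewrite xyE in H *; lia.
  apply: (Zmult_lt_reg_r _ _ (8 * D)); first lia.
  have := Zmult_lt_compat_l _ _ S S0 H3.
  by lia.
have Hx : x * y < 64 + 16 * (S * S) by clear -fb f1 S1; nia.
have Hy : x * y < 64 + 16 * (D * D) by clear -eb e1 D1; nia.
have pair_done : check_pair x y -> (S = 9 /\ D = 9) \/ (S = 18 /\ D = 32).
  rewrite /check_pair -ES -ED (is_squareP Sq).
  case: Z.ltb_spec => xy.
    by case/andP => /Z.eqb_spec ? /Z.eqb_spec ?; lia.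
  case: Z.eqb_spec => // _ /all_uptoP He.
  have /He : 1 <= e <= Z.sqrt (16 * (D * D) / (x * y - 64)).
    split; first lia.
    apply/Z.sqrt_le_square; [ | lia | ].
      by apply: Z.div_pos; lia.
    by apply: Z.div_le_lower_bound; lia.
  rewrite /check_e -ES -ED -Ef.
  have -> : 8 * D * (f * f) / (8 * D) = f * f by rewrite Z.mul_comm Z.div_mul; lia.
  have -> : 8 * D * (f * f) mod (8 * D) = 0 by rewrite Z.mul_comm Z.mod_mul; lia.
  rewrite (is_squareP (erefl (f * f))).
  case: Z.ltb_spec => [_ /= | ]; last by clear -f1 D0; nia.
  by case/andP => /Z.eqb_spec ? /Z.eqb_spec ?; lia.
have [x30 | x30] : x < 30 \/ 30 <= x by lia.
  by apply: pair_done; case: (@finite_range x y) => //; rewrite -?ES; lia.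
have [y30 | y30] : y < 30 \/ 30 <= y by lia.
  by apply: pair_done; case: (@finite_range y x) => //; rewrite -?ED; lia.
exfalso; clear pair_done Hx Hy.
(* Multiplying [eb] and [fb] gives e f (x y - 64) < 16 D S, so this estimate yields e f < 28. *)
have XY : 16 * (D * S) <= 28 * (x * y - 64).
  have : 0 <= (x - 30) * (y - 30) by apply: Z.mul_nonneg_nonneg; lia.
  by rewrite ES ED; lia.
have xy0 : 0 < x * y - 64.
  have : 0 <= (x - 30) * (y - 30) by apply: Z.mul_nonneg_nonneg; lia.
  by lia.
have ef0 : 1 <= e * f by clear -e0 f0; nia.
have ef : e * f <= 27.
  have DS0 : 0 <= D * S by clear -D0 S0; nia.
  have H : e * f * (x * y - 64) < 16 * (D * S).
    apply: sqr_lt; first lia.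
    have := Z.mul_lt_mono_nonneg _ _ _ _
      (ltac:(clear -e1 xy0; nia) : 0 <= e * e * (x * y - 64)) eb
      (ltac:(clear -f1 xy0; nia) : 0 <= f * f * (x * y - 64)) fb.
    by lia.
  have : e * f < 28 by apply: (Zmult_lt_reg_r _ _ (x * y - 64)); lia.
  by lia.
(* Both are positive, since w x = 8 D (f^2 + 16) and S q = w f^2. *)
pose w := e * e * S - 16 * D; pose q := e * e * (f * f + 16) - 2 * w.
have wx : w * x = 8 * D * (f * f + 16) by rewrite /w; have ? := ES; subst S; lia.
have w0 : 0 < w.
  by apply: (Zmult_lt_reg_r _ _ x); [lia | rewrite wx; clear -f1 D0; nia].
have Sq' : S * q = w * (f * f).
  have : 2 * (w * x) = (e * e * S - w) * (f * f + 16) by rewrite wx /w; lia.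
  by rewrite /q ES; lia.
have q0 : 0 < q.
  by apply: (Zmult_lt_reg_r _ _ S S0); rewrite (Z.mul_comm q) Sq'; clear -f1 w0; nia.
have qN : e * e * (f * f) * (f * f + 16) = (2 * S + f * f) * q by rewrite /q in Sq' *; lia.
have := all_uptoP large_checked (ltac:(clear -ef e0 f0; nia) : 1 <= e <= 27).
move/all_uptoP=> /(_ f) H.
have {}H := H (ltac:(split; [lia | apply: Z.div_le_lower_bound; lia])).
move/all_uptoP: H => /(_ q) H.
have {}H : check_triple e f q.
  apply: H; split; first lia.
  apply: Z.div_le_lower_bound; first by clear -f1; lia.
  rewrite qN; apply: Z.mul_le_mono_nonneg_r; lia.
move: H; rewrite /check_triple qN Z.mod_mul ?Z.div_mul; [ | lia | lia].
have -> : 2 * S + f * f - f * f = S * 2 by lia.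
have -> : e * e * (S * 2 - f * f - 16) + q = D * 32 by rewrite /q /w; lia.
rewrite !Z.div_mul // !Z.mod_mul //.
have -> : e * e * S * (S + D) mod (8 * D) = 0.
  by rewrite -Es Z.mul_comm Z.mod_mul; lia.
rewrite (is_squareP Sq).
by case: (Z.leb_spec 30 (D - 8)); case: (Z.ltb_spec (D * f) (e * S)) => //=; lia.
Qed.

(** * The classification of the integer solutions *)

Lemma classification (S T e f s : Z) :
  0 < S -> 0 < T -> 0 < e -> 0 < s -> f <> 0 ->
  8 * (s * s) * (T - S) = e * e * S * T ->
  8 * (T - S) * (f * f) = S * (e * e * (S - 8) - 16 * (T - S)) ->
  (T - S) * f < e * S -> - (T - S) * f < e * S ->
  (S - 8) * (T - S - 8) <> 64 ->
  [\/ S = 9 /\ T = 18 \/ S = 18 /\ T = 50,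
      exists m, (S = 5 * (m * m) /\ T = 5 * (m * m) + 5) /\
        exists n Y Z, m * m - 10 * (n * n) = -1 /\
          (5 * (m * m) - 8) * (Y * Y) = 5 + 8 * (Z * Z)
    | exists m, (S = m * m /\ T = m * m + 1) /\
        exists n Y Z, m * m - 2 * (n * n) = -1 /\
          (m * m - 8) * (Y * Y) = 1 + 8 * (Z * Z)].
Proof.
move=> S0 T0 e0 s0 f0 Es Ef f1 f2 ndeg.
pose D := T - S; have ET : T = S + D by rewrite /D; lia.
rewrite -/D in Es Ef f1 f2 ndeg; clearbody D; subst T.
have e1 : 1 <= e * e by clear -e0; nia.
have F1 : 1 <= f * f by clear -f0; nia.
have D0 : 0 < D.
  apply: (Zmult_lt_reg_r _ _ (s * s)); first by clear -s0; nia.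
  have : 0 < e * e * (S * (S + D)) by apply: Z.mul_pos_pos; [lia | apply: Z.mul_pos_pos].
  by lia.
have S8 : 8 < S.
  apply: (Zmult_lt_reg_r _ _ (e * e)); first lia.
  apply: (Zmult_lt_reg_r _ _ S) => //.
  have := Z.mul_pos_pos D (f * f) D0 ltac:(lia).
  have := Z.mul_pos_pos D S D0 S0.
  by lia.
(* [z] is 4 s D / e, an integer because its square is one. *)
have [z [_ Sq]] : exists z, 4 * s * D = e * z /\ z * z = 2 * S * (S + D) * D.
  apply: sqr_quotient; first lia.
  have : D * (8 * (s * s) * D) = D * (e * e * S * (S + D)) by rewrite Es.
  by lia.
have [D8 | D9] : D <= 8 \/ 9 <= D by lia.
  have : D = 1 \/ D = 2 \/ D = 3 \/ D = 4 \/ D = 5 \/ D = 6 \/ D = 7 \/ D = 8 by lia.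
  move=> [? | [? | [? | [? | [? | [? | [? | ?]]]]]]]; subst D.
  - have [m [n [Y [W [ESm H1 H2]]]]] := gap1 S8 Sq Ef.
    apply: Or33; exists m; split; first lia.
    by exists n, Y, W.
  - by have := gap2 S8 Sq.
  - by have := gap3 S8 Sq Ef.
  - by have := gap4 S8 Sq Ef.
  - have [m [n [Y [W [ESm H1 H2]]]]] := gap5 S8 Sq Ef.
    apply: Or32; exists m; split; first lia.
    by exists n, Y, W.
  - by have := gap6 S8 Sq Ef.
  - by have := gap7 S8 Sq Ef.
  - by have := gap8 S8 Sq.
apply: Or31.
have := @sporadic S D (S - 8) (D - 8) e (Z.abs f) s z.
case; [lia | lia | lia | lia | lia | lia | lia | lia | | | | lia | lia].
- by rewrite -Z.abs_mul Z.abs_eq; lia.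
- by lia.
- by lia.
Qed.

End Integers.

(** * Plane geometry *)

Import Order.TTheory GRing.Theory Num.Theory.
Local Open Scope ring_scope.

Section Plane.
Variable R : realType.
Implicit Types P Q S X K O A B C : point R.

(** * Distances, tangents and the excircle *)

Definition dot P Q S : R :=
  (Q.1 - P.1) * (S.1 - P.1) + (Q.2 - P.2) * (S.2 - P.2).

Lemma sqr_dist P Q : dist P Q ^+ 2 = (Q.1 - P.1) ^+ 2 + (Q.2 - P.2) ^+ 2.
Proof. by rewrite sqr_sqrtr ?addr_ge0 ?sqr_ge0. Qed.

Lemma dist_ge0 P Q : 0 <= dist P Q. Proof. exact: sqrtr_ge0. Qed.

Lemma distC P Q : dist P Q = dist Q P.
Proof. by congr Num.sqrt; ring. Qed.

Lemma dist_eq_sqr P Q P' Q' :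
  (dist P Q == dist P' Q') = (dist P Q ^+ 2 == dist P' Q' ^+ 2).
Proof. by rewrite eqrXn2 ?dist_ge0. Qed.

Lemma dist_lt_sqr P Q P' Q' :
  (dist P Q < dist P' Q') = (dist P Q ^+ 2 < dist P' Q' ^+ 2).
Proof. by rewrite ltr_pXn2r ?nnegrE ?dist_ge0. Qed.

Lemma dist_triangle P Q S : dist P S <= dist P Q + dist Q S.
Proof.
rewrite -(@ler_pXn2r _ 2) ?nnegrE ?addr_ge0 ?dist_ge0 //.
have /ler_normlW H : `|(Q.1 - P.1) * (S.1 - Q.1) + (Q.2 - P.2) * (S.2 - Q.2)|
    <= dist P Q * dist Q S.
  rewrite -(@ler_pXn2r _ 2) ?nnegrE ?mulr_ge0 ?dist_ge0 //.
  rewrite real_normK ?num_real // exprMn !sqr_dist -subr_ge0.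
  set D := (D in 0 <= D).
  have -> : D = ((Q.1 - P.1) * (S.2 - Q.2) - (Q.2 - P.2) * (S.1 - Q.1)) ^+ 2.
    by rewrite /D; ring.
  exact: sqr_ge0.
rewrite sqrrD !sqr_dist; move: H; rewrite mulr2n; lra.
Qed.

Lemma dist_gt0 P Q S : orient P Q S != 0 -> 0 < dist P Q.
Proof.
move=> H; rewrite lt_def dist_ge0 andbT; apply: contraNneq H => H.
have : dist P Q ^+ 2 = 0 by rewrite H expr0n.
rewrite sqr_dist => /eqP; rewrite paddr_eq0 ?sqr_ge0 // !sqrf_eq0.
by case/andP => /eqP H1 /eqP H2; rewrite /orient H1 H2 !mul0r subrr.
Qed.

(* The origin is a vertex, x and y are the sides there and k is the centre: the
   two tangents have equal length, and lie on opposite sides of the vertex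
   because the circle is to the left of both directed lines. *)
Lemma tangent_lengths (x1 x2 y1 y2 k1 k2 a b r : R) :
  a ^+ 2 = x1 ^+ 2 + x2 ^+ 2 -> b ^+ 2 = y1 ^+ 2 + y2 ^+ 2 ->
  x1 * k2 - x2 * k1 = r * a -> y1 * k2 - y2 * k1 = r * b ->
  x1 * y2 - x2 * y1 != 0 ->
  b * (k1 * x1 + k2 * x2) = - a * (k1 * y1 + k2 * y2).
Proof.
move=> a2 b2 xr yr xy.
have lagrange u1 u2 : (k1 * u1 + k2 * u2) ^+ 2
    = (u1 ^+ 2 + u2 ^+ 2) * (k1 ^+ 2 + k2 ^+ 2) - (u1 * k2 - u2 * k1) ^+ 2.
  by ring.
have H : (b * (k1 * x1 + k2 * x2)) ^+ 2 = (a * (k1 * y1 + k2 * y2)) ^+ 2.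
  by rewrite !exprMn !lagrange xr yr -a2 -b2; ring.
have /eqP := H; rewrite eqf_sqr => /orP[|] /eqP E; last by rewrite E mulNr.
have K0 : (k1 ^+ 2 + k2 ^+ 2) * (x1 * y2 - x2 * y1) = 0.
  transitivity ((x1 * k2 - x2 * k1) * (k1 * y1 + k2 * y2)
                - (y1 * k2 - y2 * k1) * (k1 * x1 + k2 * x2)); first by ring.
  by rewrite xr yr -!mulrA E subrr.
move/eqP: K0; rewrite mulf_eq0 (negPf xy) orbF paddr_eq0 ?sqr_ge0 // !sqrf_eq0.
by case/andP => /eqP -> /eqP ->; rewrite !mul0r !addr0 !mulr0.
Qed.

Lemma orient_sum O A B C K :
  orient O A K + orient A B K + orient B C K + orient C O K
  = 2 * area O A B C.
Proof. by rewrite /orient /area; field. Qed.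

Lemma area_diagonals O A B C :
  orient O A C + orient A B C = 2 * area O A B C /\
  orient O A B + orient O B C = 2 * area O A B C.
Proof. by split; rewrite /orient /area; field. Qed.

(** The four orientations add up to twice the area, which is positive; by the triangle inequality, a
    negative sign at OA or CO would make the sum at most 0. *)
Lemma excircle_sides O A B C K r :
  0 < area O A B C -> excircle O A B C K r -> outside_vertex_B A B C K ->
  [/\ orient O A K = r * dist O A, orient A B K = - (r * dist A B),
      orient B C K = - (r * dist B C) & orient C O K = r * dist C O].
Proof.
move=> ar [r0 [tOA tAB tBC tCO] _] [oAB oBC].
rewrite /tangent_line in tOA tAB tBC tCO.
have EAB : orient A B K = - (r * dist A B) by rewrite -tAB ltr0_norm // opprK.
have EBC : orient B C K = - (r * dist B C) by rewrite -tBC ltr0_norm // opprK.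
have S := orient_sum O A B C K; rewrite EAB EBC in S.
have T1 : dist O A <= dist C O + dist B C + dist A B.
  have := dist_triangle O C A; have := dist_triangle C B A.
  by rewrite [dist O C]distC [dist C B]distC [dist B A]distC; lra.
have T2 : dist C O <= dist O A + dist A B + dist B C.
  have := dist_triangle C B O; have := dist_triangle B A O.
  by rewrite [dist C B]distC [dist B A]distC [dist A O]distC; lra.
have a0 := dist_ge0 O A; have b0 := dist_ge0 A B.
have c0 := dist_ge0 B C; have d0 := dist_ge0 C O.
move: tOA tCO; case: (ger0P (orient O A K)) => _ tOA; case: (ger0P (orient C O K)) => _ tCO.
- by split.
- by exfalso; have := ler_wpM2l (ltW r0) T1; lra.
- by exfalso; have := ler_wpM2l (ltW r0) T2; lra.
- exfalso; have := mulr_ge0 (ltW r0) a0; have := mulr_ge0 (ltW r0) b0.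
  have := mulr_ge0 (ltW r0) c0; have := mulr_ge0 (ltW r0) d0; lra.
Qed.

(* Each side is the sum or the difference of the tangent lengths t O, t A, t B,
   t C at its end points, so a + b = t O + t B = c + d. *)
Lemma extangential_sum O A B C K r : quadrilateral O A B C ->
  orient O A K = r * dist O A -> orient A B K = - (r * dist A B) ->
  orient B C K = - (r * dist B C) -> orient C O K = r * dist C O ->
  dist O A + dist A B = dist B C + dist C O.
Proof.
move=> [[OAB OAC OBC ABC] _] oOA oAB oBC oCO.
have a0 : 0 < dist O A by apply: dist_gt0 OAB.
have b0 : 0 < dist A B by apply: dist_gt0 ABC.
have c0 : 0 < dist B C.
  by apply: (@dist_gt0 _ _ O); move: OBC; congr (_ != _); rewrite /orient; ring.
have d0 : 0 < dist C O.
  by apply: (@dist_gt0 _ _ A); move: OAC; congr (_ != _); rewrite /orient; ring.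
have a2 := sqr_dist O A; have b2 := sqr_dist A B.
have c2 := sqr_dist B C; have d2 := sqr_dist C O.
move: a0 b0 c0 d0 a2 b2 c2 d2 oOA oAB oBC oCO.
move: (dist O A) (dist A B) (dist B C) (dist C O) => a b c d.
move=> a0 b0 c0 d0 a2 b2 c2 d2 oOA oAB oBC oCO.
rewrite /orient in oOA oAB oBC oCO OAB OAC OBC ABC.
have TO : d * dot O K A = a * dot O K C.
  have H := @tangent_lengths (A.1 - O.1) (A.2 - O.2) (O.1 - C.1) (O.2 - C.2)
    (K.1 - O.1) (K.2 - O.2) a d r a2 d2 oOA.
  rewrite /dot [LHS]H; [ring | by rewrite -oCO; ring |].
  by apply: contraNneq OAC => H0; rewrite -oppr_eq0 -H0; apply/eqP; ring.
have TA : b * dot A K O = - a * dot A K B.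
  have H := @tangent_lengths (A.1 - O.1) (A.2 - O.2) (A.1 - B.1) (A.2 - B.2)
    (K.1 - A.1) (K.2 - A.2) a b r a2.
  transitivity (- (b * ((K.1 - A.1) * (A.1 - O.1) + (K.2 - A.2) * (A.2 - O.2)))).
    by rewrite /dot; ring.
  rewrite H; [by rewrite /dot; ring | by rewrite b2; ring | by rewrite -oOA; ring | |].
    by rewrite -[r * b]opprK -oAB; ring.
  by apply: contraNneq OAB => H0; rewrite -oppr_eq0 -H0; apply/eqP; ring.
have TB : c * dot B K A = b * dot B K C.
  have H := @tangent_lengths (A.1 - B.1) (A.2 - B.2) (B.1 - C.1) (B.2 - C.2)
    (K.1 - B.1) (K.2 - B.2) b c r.
  rewrite /dot [LHS]H; [ring | by rewrite b2; ring | by rewrite c2; ring | | |].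
  - by rewrite -[r * b]opprK -oAB; ring.
  - by rewrite -[r * c]opprK -oBC; ring.
  by apply: contraNneq ABC => H0; rewrite -H0; apply/eqP; ring.
have TC : c * dot C K O = - d * dot C K B.
  have H := @tangent_lengths (O.1 - C.1) (O.2 - C.2) (B.1 - C.1) (B.2 - C.2)
    (K.1 - C.1) (K.2 - C.2) d c r d2.
  rewrite /dot [LHS]H; [ring | by rewrite c2; ring | by rewrite -oCO; ring | |].
    by rewrite -[r * c]opprK -oBC; ring.
  by apply: contraNneq OBC => H0; rewrite -H0; apply/eqP; ring.
have Sa : a * a = dot O K A + dot A K O by rewrite -expr2 a2 /dot; ring.
have Sb : b * b = dot A K B + dot B K A by rewrite -expr2 b2 /dot; ring.
have Sc : c * c = dot B K C + dot C K B by rewrite -expr2 c2 /dot; ring.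
have Sd : d * d = dot C K O + dot O K C by rewrite -expr2 d2 /dot; ring.
move: TO TA TB TC Sa Sb Sc Sd.
have [a1 b1 c1 d1] : [/\ a != 0, b != 0, c != 0 & d != 0] by rewrite !gt_eqF.
(* The quotients [tO], [tA], [tB], [tC] are signed tangent lengths: the projections of the vectors
   from the vertices to [K] on OA, AB, BA and CO. *)
rewrite -(divfK a1 (dot O K A)) -(divfK b1 (dot A K B)).
rewrite -(divfK b1 (dot B K A)) -(divfK d1 (dot C K O)).
move: (dot O K A / a) (dot A K B / b) (dot B K A / b) (dot C K O / d).
move: (dot O K C) (dot A K O) (dot B K C) (dot C K B) => u v w z tO tA tB tC.
move=> TO TA TB TC Sa Sb Sc Sd.
have Eu : u = d * tO by apply: (mulfI a1); rewrite -TO; ring.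
have Ev : v = - a * tA by apply: (mulfI b1); rewrite TA; ring.
have Ew : w = c * tB by apply: (mulfI b1); rewrite -TB; ring.
have Ez : z = - c * tC by apply: (mulfI d1); apply: oppr_inj; rewrite -mulNr -TC; ring.
have -> : a = tO - tA by apply: (mulfI a1); rewrite Sa Ev; ring.
have -> : b = tA + tB by apply: (mulfI b1); rewrite Sb; ring.
have -> : c = tB - tC by apply: (mulfI c1); rewrite Sc Ew Ez; ring.
have -> : d = tC + tO by apply: (mulfI d1); rewrite Sd Eu; ring.
ring.
Qed.

(* For opposite angles al and be enclosed by sides with products u and v, m is
   u (1 - cos al) = v (1 - cos be), g and g' are the cross products, and
   N = - sqrt (u v) cos ((al + be) / 2). *)
Lemma opposite_angles (u v g g' m s : R) : 0 < u -> 0 < s -> g != 0 ->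
  g ^+ 2 = m * (2 * u - m) -> g' ^+ 2 = m * (2 * v - m) -> g + g' = 4 * s ->
  exists N, [/\ 0 < m,
    [/\ N ^+ 2 = u * v - 4 * s ^+ 2,
        g * (v - m) + g' * (u - m) = - (4 * s * N) &
        (u + v - 2 * N) * m = 8 * s ^+ 2],
    (g - g') * (2 * s) = m * (u - v) &
    2 * (u + v + 2 * N) * m = (g - g') ^+ 2 + 4 * m ^+ 2].
Proof.
move=> u0 s0 g0 Hg Hg' S.
have m0 : 0 < m.
  have H : 0 < m * (2 * u - m) by rewrite -Hg exprn_even_gt0.
  have [// | m0] := ltrP 0 m.
  by move: H; rewrite pmulr_lgt0 ?ltNge ?m0 //; lra.
have m1 := lt0r_neq0 m0.
have -> : u = (g ^+ 2 / m + m) / 2 by rewrite Hg; field.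
have -> : v = (g' ^+ 2 / m + m) / 2 by rewrite Hg'; field.
have -> : s = (g + g') / 4 by rewrite S; field.
(* Since g = m cot(al/2) and g' = m cot(be/2), this is (m/2)(1 - cot(al/2) cot(be/2)). *)
exists ((m ^+ 2 - g * g') / (2 * m)).
by do !split => //; field.
Qed.

(* g, g', h, h' are twice the areas of OAC, ABC, OAB, OBC. *)
Section ExcircleRelations.
Variables a b c d g g' h h' S T s : R.
Hypotheses (a0 : 0 < a) (b0 : 0 < b) (d0 : 0 < d).
Hypotheses (ab : s = a + b) (cd : s = c + d) (g0 : g != 0) (h0 : h != 0).
Hypotheses (g2 : g ^+ 2 = S * (2 * (a * d) - S)).
Hypotheses (g'2 : g' ^+ 2 = S * (2 * (b * c) - S)).
Hypotheses (h2 : h ^+ 2 = T * (2 * (a * b) - T)).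
Hypotheses (h'2 : h' ^+ 2 = T * (2 * (c * d) - T)).
Hypotheses (gs : g + g' = 4 * s) (hs : h + h' = 4 * s).
Hypothesis gh : g * (b * c - S) + g' * (a * d - S)
  = h * (c * d - T) + h' * (a * b - T).

(** [opposite_angles] is applied to the angles at O and B, and to the supplements of those at A and
    C. Both pairs have the same sum, so they share one [N]; [gh] expresses this. *)
Lemma excircle_relations : exists N,
  [/\ 0 < S /\ 0 < T,
      [/\ g = 2 * s + S * (a - c) / 4, g' = 2 * s - S * (a - c) / 4,
          h * s = 2 * s ^+ 2 - T * (a - c) * (a - d) / 4 &
          h' * s = 2 * s ^+ 2 + T * (a - c) * (a - d) / 4],
      N ^+ 2 = a * b * c * d - 4 * s ^+ 2 /\
        g * (b * c - S) + g' * (a * d - S) = - (4 * s * N),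
      8 * (a * d + b * c + 2 * N) = S * (16 + (a - c) ^+ 2) /\
        8 * s ^+ 2 * (a * b + c * d + 2 * N)
        = T * (16 * s ^+ 2 + (a - c) ^+ 2 * (a - d) ^+ 2) &
      8 * s ^+ 2 * (T - S) = (a - c) ^+ 2 * S * T /\
        8 * (T - S) * (a - d) ^+ 2
        = S * ((a - c) ^+ 2 * (S - 8) - 16 * (T - S))].
Proof.
have s0 : 0 < s by rewrite ab addr_gt0.
have [N [S0 [N2 gN XS] gd YS]] :=
  opposite_angles (mulr_gt0 a0 d0) s0 g0 g2 g'2 gs.
have [N' [T0 [N'2 hN XT] hd YT]] :=
  opposite_angles (mulr_gt0 a0 b0) s0 h0 h2 h'2 hs.
have EN : N' = N.
  apply: (@mulfI _ (4 * s)); first by rewrite mulf_neq0 ?pnatr_eq0 ?gt_eqF.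
  by apply: oppr_inj; rewrite -hN -gN gh.
rewrite {}EN in N'2 hN XT YT; exists N.
have s1 := lt0r_neq0 s0; have S1 := lt0r_neq0 S0; have T1 := lt0r_neq0 T0.
have Eb : b = s - a by rewrite ab; ring.
have Ed : d = s - c by rewrite cd; ring.
have {}gd : g - g' = S * (a - c) / 2.
  apply: (@mulIf _ (2 * s)); first by rewrite mulf_neq0 ?pnatr_eq0.
  by rewrite gd Eb Ed; field.
have {}hd : (h - h') * s = - (T * (a - c) * (a - d) / 2).
  apply: (@mulfI _ 2); first by rewrite pnatr_eq0.
  transitivity (T * (a * b - c * d)); first by rewrite -hd; ring.
  by rewrite Eb Ed; field.
have XS' : a * d + b * c - 2 * N = 8 * s ^+ 2 / S by rewrite -XS mulfK.
have XT' : a * b + c * d - 2 * N = 8 * s ^+ 2 / T by rewrite -XT mulfK.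
have YS' : 8 * (a * d + b * c + 2 * N) = S * (16 + (a - c) ^+ 2).
  apply: (mulIf S1); apply: (@mulfI _ 2); first by rewrite pnatr_eq0.
  transitivity (8 * (2 * (a * d + b * c + 2 * N) * S)); first by ring.
  by rewrite YS gd; field.
(* Subtracting the values of 8 s^2 / S and 8 s^2 / T cancels [N]. *)
have Es : 8 * s ^+ 2 * (T - S) = (a - c) ^+ 2 * S * T.
  have -> : (a - c) ^+ 2 = (a * d + b * c - 2 * N) - (a * b + c * d - 2 * N).
    by rewrite Eb Ed; ring.
  by rewrite XS' XT'; field; rewrite S1 T1.
split => //.
- split.
  + by move: gd gs; move: (S * (a - c)) => z; lra.
  + by move: gd gs; move: (S * (a - c)) => z; lra.
  + have -> : h * s = ((h + h') * s + (h - h') * s) / 2 by field.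
    by rewrite hs hd; field.
  + have -> : h' * s = ((h + h') * s - (h - h') * s) / 2 by field.
    by rewrite hs hd; field.
- by split => //; rewrite N2; ring.
- split => //.
  apply: (mulIf T1); apply: (@mulfI _ 2); first by rewrite pnatr_eq0.
  transitivity (8 * s ^+ 2 * (2 * (a * b + c * d + 2 * N) * T)); first by ring.
  rewrite YT.
  transitivity (8 * (((h - h') * s) ^+ 2 + 4 * T ^+ 2 * s ^+ 2)); first by ring.
  by rewrite hd; field.
- split => //.
  apply: (mulfI S1).
  (* [YS'] and [XS] contain [N] with opposite signs, so that it cancels. *)
  have E : 8 * S * (a - d) ^+ 2
      = 8 * S * s ^+ 2 + 8 * S * (a - c) ^+ 2 - S ^+ 2 * (16 + (a - c) ^+ 2)
        - 64 * s ^+ 2.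
    transitivity (8 * S * s ^+ 2 + 8 * S * (a - c) ^+ 2
        - S * (8 * (a * d + b * c + 2 * N))
        - 8 * ((a * d + b * c - 2 * N) * S)); first by rewrite Eb Ed; ring.
    by rewrite YS' XS; ring.
  transitivity ((T - S) * (8 * S * (a - d) ^+ 2)); first by ring.
  rewrite E; transitivity (S * (8 * s ^+ 2 * (T - S))
    + 8 * S * (a - c) ^+ 2 * (T - S) - S ^+ 2 * (16 + (a - c) ^+ 2) * (T - S)
    - 8 * (8 * s ^+ 2 * (T - S))); first by ring.
  by rewrite Es; ring.
Qed.
End ExcircleRelations.

(** * Crossing sides, and the signs of OAB and OBC *)

(** x / (x - y) is the parameter at which an affine function with end values [x] and [y]
    vanishes. *)
Lemma opposite_signs (x y : R) : x * y < 0 -> x - y != 0 /\ 0 < x / (x - y) < 1.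
Proof.
move=> xy; have [x0 | x0 | x0] := ltrgt0P x; last by rewrite x0 mul0r ltxx in xy.
  have y0 : y < 0 by rewrite pmulr_rlt0 in xy.
  have D0 : 0 < x - y by lra.
  by split; [rewrite gt_eqF | rewrite divr_gt0 // ltr_pdivrMr // mul1r; lra].
have y0 : 0 < y by rewrite nmulr_rlt0 in xy.
have D0 : 0 < y - x by lra.
have -> : x / (x - y) = - x / (y - x) by rewrite -[x - y]opprB invrN mulrN mulNr.
split; first by rewrite -opprB oppr_eq0 gt_eqF.
by rewrite divr_gt0 ?oppr_gt0 // ltr_pdivrMr // mul1r; lra.
Qed.

Lemma crossing P Q S X :
  orient P Q S * orient P Q X < 0 -> orient S X P * orient S X Q < 0 ->
  ~ interiors_disjoint P Q S X.
Proof.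
move=> /opposite_signs [D1 u01] /opposite_signs [D2 t01].
set t := (t in 0 < t < 1) in t01; set u := (u in 0 < u < 1) in u01.
apply; split; first by exists t; split; [exact: t01 | reflexivity].
exists u; split=> //; rewrite /t /u; move: D1 D2; rewrite /orient => D1 D2.
by congr pair; field; rewrite D1 D2.
Qed.

(* A reflex angle at A or C would force a second one at the adjacent vertex B,
   and then two opposite sides cross. *)
Lemma side_triangles O A B C : quadrilateral O A B C ->
  standard_labelling O A B C -> 0 < orient O A C ->
  0 < orient O A B /\ 0 < orient O B C.
Proof.
move=> [[OAB OAC OBC ABC] [_ [disj1 disj2]]] [ar conc] g0.
have [S1 S2] := area_diagonals O A B C.
have BCO : orient B C O = orient O B C by rewrite /orient; ring.
have COA : orient C O A = orient O A C by rewrite /orient; ring.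
have BCA : orient B C A = orient A B C by rewrite /orient; ring.
have ABO : orient A B O = orient O A B by rewrite /orient; ring.
have COB : orient C O B = orient O B C by rewrite /orient; ring.
split; rewrite lt_def ?OAB ?OBC /= leNgt; apply/negP => neg.
- have ref : orient A B C < 0 by apply: conc; apply: Or42.
  apply: crossing disj1; rewrite ?BCO ?BCA.
    by rewrite nmulr_rlt0.
  by rewrite pmulr_rlt0 //; lra.
- have ref : orient A B C < 0 by apply: conc; apply: Or44; rewrite /reflex BCO.
  apply: crossing disj2; rewrite ?ABO ?COA ?COB.
    by rewrite nmulr_rlt0 //; lra.
  by rewrite pmulr_rlt0.
Qed.

(** * Reflections and kites *)

Lemma reflection_affine P Q X Y (t : R) : 
  reflection P Q ((1 - t) * X.1 + t * Y.1, (1 - t) * X.2 + t * Y.2)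
  = ((1 - t) * (reflection P Q X).1 + t * (reflection P Q Y).1,
     (1 - t) * (reflection P Q X).2 + t * (reflection P Q Y).2).
Proof. by rewrite /reflection /=; congr pair; ring. Qed.

Lemma reflectionK P Q X : (Q.1 - P.1) ^+ 2 + (Q.2 - P.2) ^+ 2 != 0 ->
  reflection P Q (reflection P Q X) = X.
Proof.
by case: X => x1 x2 H; rewrite /reflection /=; congr pair; field.
Qed.

Lemma closed_segment_reflection P Q X Y W :
  closed_segment X Y W ->
  closed_segment (reflection P Q X) (reflection P Q Y) (reflection P Q W).
Proof. by move=> [t [t01 ->]]; exists t; split=> //; apply: reflection_affine. Qed.

Lemma closed_segmentC P Q X : closed_segment P Q X -> closed_segment Q P X.
Proof.
move=> [t [t01 ->]]; exists (1 - t); split; first by lra.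
by congr pair; ring.
Qed.

(** [X] and [Y] have the same projection on PQ, so their signed distances from PQ agree up to sign;
    equal ones would make P, X, Y collinear. *)
Lemma reflection_equidistant P Q X Y : orient P X Y != 0 ->
  (Q.1 - P.1) ^+ 2 + (Q.2 - P.2) ^+ 2 != 0 ->
  dist P X = dist P Y -> dist Q X = dist Q Y -> reflection P Q X = Y.
Proof.
move=> XY PQ /(congr1 (fun z => z ^+ 2)) EP /(congr1 (fun z => z ^+ 2)) EQ.
rewrite !sqr_dist in EP EQ.
set n := (_ + _) in PQ.
have inner : dot P X Q = dot P Y Q by rewrite /dot; lra.
have cross : orient P Q X + orient P Q Y = 0.
  have /eqP : orient P Q X ^+ 2 = orient P Q Y ^+ 2.
    have lagrange Z : orient P Q Z ^+ 2
        = ((Z.1 - P.1) ^+ 2 + (Z.2 - P.2) ^+ 2) * n - dot P Z Q ^+ 2.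
      by rewrite /orient /dot /n; ring.
    by rewrite !lagrange EP inner.
  rewrite eqf_sqr => /orP[] /eqP E; last by rewrite E addNr.
  case/eqP: XY; apply: (mulfI PQ); rewrite mulr0.
  transitivity (dot P X Q * orient P Q Y - orient P Q X * dot P Y Q).
    by rewrite /orient /dot /n; ring.
  by rewrite inner E mulrC subrr.
rewrite [Y]surjective_pairing /reflection -/(dot P X Q) -/n /=.
congr pair; apply: (mulfI PQ).
- transitivity (2 * dot P X Q * (Q.1 - P.1) + n * (2 * P.1 - X.1)).
    by field.
  transitivity ((dot P X Q + dot P Y Q) * (Q.1 - P.1) + n * (2 * P.1 - X.1)
    - (orient P Q X + orient P Q Y) * (Q.2 - P.2)).
    by rewrite cross -inner; ring.
  by rewrite /dot /orient /n; ring.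
- transitivity (2 * dot P X Q * (Q.2 - P.2) + n * (2 * P.2 - X.2)).
    by field.
  transitivity ((dot P X Q + dot P Y Q) * (Q.2 - P.2) + n * (2 * P.2 - X.2)
    + (orient P Q X + orient P Q Y) * (Q.1 - P.1)).
    by rewrite cross -inner; ring.
  by rewrite /dot /orient /n; ring.
Qed.

Lemma kite_of_sides O A B C :
  orient O A C != 0 -> orient O A B != 0 ->
  dist O A = dist C O -> dist A B = dist B C -> kite O A B C.
Proof.
move=> OAC OAB ad bc; left.
have OB : (B.1 - O.1) ^+ 2 + (B.2 - O.2) ^+ 2 != 0.
  rewrite -sqr_dist sqrf_eq0 gt_eqF //; apply: (@dist_gt0 _ _ A).
  by rewrite -oppr_eq0; apply: contraNneq OAB => <-; apply/eqP; rewrite /orient; ring.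
have rA : reflection O B A = C.
  by apply: reflection_equidistant => //; rewrite 1?(distC O C) // (distC B A).
have rC : reflection O B C = A by rewrite -rA reflectionK.
have rO : reflection O B O = O.
  by case: O {rA rC OAC OAB ad bc} OB => o1 o2 OB; rewrite /reflection /=; congr pair; field.
have rB : reflection O B B = B.
  by case: B {rA rC rO OAB bc} OB => b1 b2 OB; rewrite /reflection /=; congr pair; field.
have stable X : on_sides O A B C X -> on_sides O A B C (reflection O B X).
  case=> /(closed_segment_reflection O B); rewrite ?rO ?rA ?rB ?rC => /closed_segmentC.
  - exact: Or44.
  - exact: Or43.
  - exact: Or42.
  - exact: Or41.
by move=> X; split=> /stable //; rewrite reflectionK.
Qed.

(** * The circumcircle of OAC and the sign [delta] *)

(** The power of [B] with respect to the circumcircle is expressed without the centre, so its sign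
    can be compared with that of [N]. *)
Lemma power_of_point O A B C K :
  dist K O = dist K A -> dist K A = dist K C ->
  (dist K B ^+ 2 - dist K O ^+ 2) * orient O A C
  = orient O A C * dot B A C + orient A B C * dot O A C.
Proof.
move=> EA EC; have {}EC := etrans EA EC.
move: EA EC => /(congr1 (fun z => z ^+ 2)) EA /(congr1 (fun z => z ^+ 2)) EC.
transitivity ((dist K B ^+ 2 - dist K O ^+ 2) * orient O A C
   + orient O B C * (dist K O ^+ 2 - dist K A ^+ 2)
   + orient O A B * (dist K O ^+ 2 - dist K C ^+ 2)).
  by rewrite EC -EA EC !subrr !mulr0 !addr0.
by rewrite !sqr_dist /orient /dot; ring.
Qed.

Lemma circumcenter_exists O A C : orient O A C != 0 ->
  exists K, dist K O = dist K A /\ dist K A = dist K C.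
Proof.
move=> g0; set g := orient O A C in g0.
pose p := dist O A ^+ 2; pose q := dist O C ^+ 2.
(* Cramer's rule for the perpendicular bisectors of OA and OC. *)
exists (O.1 + (p * (C.2 - O.2) - q * (A.2 - O.2)) / (2 * g),
        O.2 + (q * (A.1 - O.1) - p * (C.1 - O.1)) / (2 * g)).
suff H X : dist O X ^+ 2 * g = (p * (C.2 - O.2) - q * (A.2 - O.2)) * (X.1 - O.1)
    + (q * (A.1 - O.1) - p * (C.1 - O.1)) * (X.2 - O.2) ->
    dist (O.1 + (p * (C.2 - O.2) - q * (A.2 - O.2)) / (2 * g),
          O.2 + (q * (A.1 - O.1) - p * (C.1 - O.1)) / (2 * g)) X
    = dist (O.1 + (p * (C.2 - O.2) - q * (A.2 - O.2)) / (2 * g),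
          O.2 + (q * (A.1 - O.1) - p * (C.1 - O.1)) / (2 * g)) O.
  by split; rewrite !H // /g /orient /p /q; ring.
move: (p * _ - _) (q * _ - _) => v w E.
apply/eqP; rewrite dist_eq_sqr; apply/eqP.
rewrite sqr_dist in E; rewrite !sqr_dist /=.
apply: (mulfI g0).
transitivity (g * ((v / (2 * g)) ^+ 2 + (w / (2 * g)) ^+ 2)
  + (((X.1 - O.1) ^+ 2 + (X.2 - O.2) ^+ 2) * g
     - (v * (X.1 - O.1) + w * (X.2 - O.2)))); first by field.
by rewrite E subrr addr0; field.
Qed.

(** The root is |N|, and the power of [B] has the sign of -N. If N = 0 the root vanishes, so the
    value of [delta] on the circle is harmless. *)
Lemma delta_sqrt O A B C (s N M : R) : 0 < s -> 0 < orient O A C ->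
  orient O A C * dot B A C + orient A B C * dot O A C = - (4 * s * N) ->
  N ^+ 2 = M -> delta O A B C * Num.sqrt M = N.
Proof.
move=> s0 g0 gN <-; rewrite sqrtr_sqr /delta.
have inside K : dist K O = dist K A -> dist K A = dist K C ->
    (dist K B < dist K O) = (0 < N).
  move=> EA EC; rewrite dist_lt_sqr -subr_lt0 -(pmulr_llt0 _ g0).
  rewrite (power_of_point _ EA EC) gN oppr_lt0 pmulr_rgt0 //; lra.
have [N0 | N0 | ->] := ltrgt0P N; last by rewrite mulr0.
  case: asboolP => [_ | []]; first by rewrite mul1r.
  have [K [EA EC]] := circumcenter_exists (lt0r_neq0 g0).
  by exists K; split=> //; rewrite inside.
case: asboolP => [[K [EA EC]] | _]; last by rewrite mulN1r opprK.
by rewrite inside // ltNge ltW.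
Qed.

(* 8 k a = k^2 + 16 m - 16 n, so a is rational, hence an integer. *)
Lemma sqrt_sum_int (a b : R) (k m n : int) : 0 < a -> 0 <= b ->
  a ^+ 2 = m%:~R -> b ^+ 2 = n%:~R -> 4 * (a + b) = k%:~R ->
  exists z : int, a = z%:~R.
Proof.
move=> a0 b0 a2 b2 abk.
have k0 : (k%:~R : R) != 0 by rewrite -abk; lra.
have kn0 : k != 0 by move: k0; rewrite intr_eq0.
have E : (8 * k)%:~R * a = (k ^+ 2 + 16 * m - 16 * n)%:~R.
  rewrite !(rmorphD, rmorphB, rmorphM, rmorphXn, rmorphN) /= -abk -a2 -b2; ring.
have E2 : (k ^+ 2 + 16 * m - 16 * n) ^+ 2 = (8 * k) ^+ 2 * m.
  by apply: (@intr_inj R); rewrite rmorphXn [RHS]rmorphM rmorphXn /= -E exprMn a2.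
move: E E2; move: (k ^+ 2 + _ - _) => P E E2.
have [z [Hz _]] : exists z : Z, Z_of_int P = Z.mul (8 * Z_of_int k)%Z z
    /\ Z.mul z z = Z_of_int m.
  by apply: sqr_quotient; lia.
exists (int_of_Z z).
have E3 : P = 8 * k * int_of_Z z by lia.
apply: (@mulfI _ (8 * k)%:~R); last by rewrite E E3 rmorphM.
by rewrite rmorphM mulf_neq0 // pnatr_eq0.
Qed.

(** * Integrality for lattice points *)

Lemma cosine_law P Q S :
  dist Q S ^+ 2 = dist P Q ^+ 2 + dist P S ^+ 2 - 2 * dot P Q S.
Proof. by rewrite !sqr_dist /dot; ring. Qed.

Lemma lagrange P Q S :
  orient P Q S ^+ 2 = dist P Q ^+ 2 * dist P S ^+ 2 - dot P Q S ^+ 2.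
Proof. by rewrite !sqr_dist /dot /orient; ring. Qed.

Lemma dist_sqr_int P Q : lattice_point P -> lattice_point Q ->
  exists m : int, dist P Q ^+ 2 = m%:~R.
Proof.
move=> [x [y ->]] [x' [y' ->]]; exists ((x' - x) ^+ 2 + (y' - y) ^+ 2).
by rewrite sqr_dist /= !(rmorphD, rmorphXn, rmorphN).
Qed.

Lemma dot_int P Q S : lattice_point P -> lattice_point Q -> lattice_point S ->
  exists m : int, dot P Q S = m%:~R.
Proof.
move=> [x [y ->]] [x' [y' ->]] [x'' [y'' ->]].
exists ((x' - x) * (x'' - x) + (y' - y) * (y'' - y)).
by rewrite /dot /= !(rmorphD, rmorphM, rmorphN).
Qed.

Lemma orient_int P Q S : lattice_point P -> lattice_point Q ->
  lattice_point S -> exists m : int, orient P Q S = m%:~R.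
Proof.
move=> [x [y ->]] [x' [y' ->]] [x'' [y'' ->]].
exists ((x' - x) * (y'' - y) - (y' - y) * (x'' - x)).
by rewrite /orient /= !(rmorphD, rmorphM, rmorphN).
Qed.

End Plane.

(** * From the integer classification to quadrilaterals *)

Lemma classification_int (S T e f s : int) :
  0 < S -> 0 < T -> 0 < e -> 0 < s -> f != 0 ->
  8 * s ^+ 2 * (T - S) = e ^+ 2 * S * T ->
  8 * (T - S) * f ^+ 2 = S * (e ^+ 2 * (S - 8) - 16 * (T - S)) ->
  (T - S) * f < e * S -> - (T - S) * f < e * S ->
  (S - 8) * (T - S - 8) != 64 ->
  [\/ (S, T) = (9, 18) \/ (S, T) = (18, 50),
      exists m : int, (S, T) = (5 * m ^+ 2, 5 * m ^+ 2 + 5) /\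
        exists n Y Z : int, m ^+ 2 - 10 * n ^+ 2 = -1 /\
          (5 * m ^+ 2 - 8) * Y ^+ 2 = 5 + 8 * Z ^+ 2
    | exists m : int, (S, T) = (m ^+ 2, m ^+ 2 + 1) /\
        exists n Y Z : int, m ^+ 2 - 2 * n ^+ 2 = -1 /\
          (m ^+ 2 - 8) * Y ^+ 2 = 1 + 8 * Z ^+ 2].
Proof.
move=> S0 T0 e0 s0 f0 Es Ef f1 f2 nd; rewrite !expr2 in Es Ef.
case: (@classification (Z_of_int S) (Z_of_int T) (Z_of_int e)
  (Z_of_int f) (Z_of_int s)); try lia.
- by case=> [] [? ?]; apply: Or31; [left | right]; congr pair; lia.
- move=> [m [[ES ET] [n [Y [W [H1 H2]]]]]]; apply: Or32.
  exists (int_of_Z m); rewrite !expr2; split; first by congr pair; lia.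
  by exists (int_of_Z n), (int_of_Z Y), (int_of_Z W); rewrite !expr2; split; lia.
- move=> [m [[ES ET] [n [Y [W [H1 H2]]]]]]; apply: Or33.
  exists (int_of_Z m); rewrite !expr2; split; first by congr pair; lia.
  by exists (int_of_Z n), (int_of_Z Y), (int_of_Z W); rewrite !expr2; split; lia.
Qed.

Theorem theorem3 (R : realType) (O A B C : point R)
    (hLEQ : LEQ O A B C)
    (hkite : ~ kite O A B C)
    (hexc : exists (K : point R) (r : R),
        excircle O A B C K r /\ outside_vertex_B A B C K) :
  exists S T : int,
    [/\ Sigma O A B C = S%:~R,
        Tau O A B C = T%:~R &
        [\/ (S, T) = (9, 18) \/ (S, T) = (18, 50),
            exists m : int,
              (S, T) = (5 * m ^+ 2, 5 * m ^+ 2 + 5) /\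
              exists n Y Z : int,
                m ^+ 2 - 10 * n ^+ 2 = -1 /\
                (5 * m ^+ 2 - 8) * Y ^+ 2 = 5 + 8 * Z ^+ 2
          | exists m : int,
              (S, T) = (m ^+ 2, m ^+ 2 + 1) /\
              exists n Y Z : int,
                m ^+ 2 - 2 * n ^+ 2 = -1 /\
                (m ^+ 2 - 8) * Y ^+ 2 = 1 + 8 * Z ^+ 2]].
Proof.
have [quad lab [lO lA lB lC] equable] := hLEQ.
have [K [r [exc out]]] := hexc.
have [[OAB OAC OBC ABC] _] := quad; have [ar _] := lab.
have [oOA oAB oBC oCO] := excircle_sides ar exc out.
have sums := extangential_sum quad oOA oAB oBC oCO.
have a0 := dist_gt0 OAB; have b0 := dist_gt0 ABC.
have c0 : 0 < dist B C.
  apply: (@dist_gt0 _ _ _ O); apply: contraNneq OBC => H.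
  by rewrite -H /orient; apply/eqP; ring.
have d0 : 0 < dist C O.
  apply: (@dist_gt0 _ _ _ A); apply: contraNneq OAC => H.
  by rewrite -H /orient; apply/eqP; ring.
have [g_sum h_sum] := area_diagonals O A B C.
have per : 2 * area O A B C = 4 * (dist O A + dist A B).
  by rewrite equable /perimeter -addrA -sums; ring.
have per' : 2 * area O A B C = 4 * (dist C O + dist B C).
  by rewrite per sums; ring.
(* The orientations sum to r (a - b - c + d) = 2 r (a - c), which is twice the area. *)
have ac : dist B C < dist O A.
  have r0 : 0 < r by case: exc.
  have H : 0 < r * (dist O A - dist B C).
    have := orient_sum O A B C K; rewrite oOA oAB oBC oCO => H.
    have : r * (dist O A - dist B C) = area O A B C.
      apply: (@mulfI _ 2); first by rewrite pnatr_eq0.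
      rewrite -H; have -> : dist C O = dist O A + dist A B - dist B C by rewrite sums; ring.
      by ring.
    by move=> ->.
  by rewrite pmulr_rgt0 // subr_gt0 in H.
have [m1 Em1] := dist_sqr_int lO lA; have [m2 Em2] := dist_sqr_int lA lB.
have [m3 Em3] := dist_sqr_int lB lC; have [m4 Em4] := dist_sqr_int lC lO.
have [k1 Ek1] := orient_int lO lA lC; have [k2 Ek2] := orient_int lA lB lC.
have per_int : 2 * area O A B C = (k1 + k2)%:~R by rewrite -g_sum Ek1 Ek2 rmorphD.
have [za Ea] : exists z : int, dist O A = z%:~R.
  by apply: (sqrt_sum_int a0 (ltW b0) Em1 Em2); rewrite -per; exact: per_int.
have [zb Eb] : exists z : int, dist A B = z%:~R.
  by apply: (sqrt_sum_int b0 (ltW a0) Em2 Em1); rewrite addrC -per; exact: per_int.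
have [zc Ec] : exists z : int, dist B C = z%:~R.
  by apply: (sqrt_sum_int c0 (ltW d0) Em3 Em4); rewrite addrC -per'; exact: per_int.
have [zd Ed] : exists z : int, dist C O = z%:~R.
  by apply: (sqrt_sum_int d0 (ltW c0) Em4 Em3); rewrite -per'; exact: per_int.
clear Em1 Em2 Em3 Em4 m1 m2 m3 m4.
have [p Ep] := dot_int lO lA lC; have [q Eq] := dot_int lA lO lB.
(* S = a d (1 - cos O) and T = a b (1 + cos A). Computing |AC|^2 and |OB|^2 in two triangles each
   gives the forms [ES'] and [ET'] at the opposite vertices. *)
pose S := za * zd - p; pose T := za * zb + q.
have ES : S%:~R = dist O A * dist C O - dot O A C.
  by rewrite rmorphB rmorphM Ea Ed Ep.
have ET : T%:~R = dist O A * dist A B + dot A O B.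
  by rewrite rmorphD rmorphM Ea Eb Eq.
clearbody S T.
have ES' : S%:~R = dist B C * dist A B - dot B A C.
  rewrite ES; apply: (@mulfI _ 2); first by rewrite pnatr_eq0.
  transitivity (dist A C ^+ 2 - (dist O A - dist C O) ^+ 2).
    by rewrite (cosine_law O) (distC O C); ring.
  rewrite (cosine_law B) (distC B A).
  have -> : dist C O = dist O A + dist A B - dist B C by rewrite sums; ring.
  by ring.
have ET' : T%:~R = dist B C * dist C O + dot C O B.
  rewrite ET; apply: (@mulfI _ 2); first by rewrite pnatr_eq0.
  transitivity ((dist O A + dist A B) ^+ 2 - dist O B ^+ 2).
    by rewrite (cosine_law A) (distC A O); ring.
  rewrite (cosine_law C) (distC C B) sums.
  by ring.
have g2 : orient O A C ^+ 2 = S%:~R * (2 * (dist O A * dist C O) - S%:~R).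
  by rewrite ES lagrange (distC O C); ring.
have g'2 : orient A B C ^+ 2 = S%:~R * (2 * (dist A B * dist B C) - S%:~R).
  have -> : orient A B C = orient B C A by rewrite /orient; ring.
  rewrite lagrange ES' (distC B A).
  have -> : dot B C A = dot B A C by rewrite /dot; ring.
  by ring.
have h2 : orient O A B ^+ 2 = T%:~R * (2 * (dist O A * dist A B) - T%:~R).
  have -> : orient O A B = - orient A O B by rewrite /orient; ring.
  by rewrite sqrrN ET lagrange (distC A O); ring.
have h'2 : orient O B C ^+ 2 = T%:~R * (2 * (dist B C * dist C O) - T%:~R).
  have -> : orient O B C = orient C O B by rewrite /orient; ring.
  by rewrite ET' lagrange (distC C B); ring.
have gs : orient O A C + orient A B C = 4 * (dist O A + dist A B).
  by rewrite g_sum.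
have hs : orient O A B + orient O B C = 4 * (dist O A + dist A B).
  by rewrite h_sum.
have gh : orient O A C * (dist A B * dist B C - S%:~R)
      + orient A B C * (dist O A * dist C O - S%:~R)
    = orient O A B * (dist B C * dist C O - T%:~R)
      + orient O B C * (dist O A * dist A B - T%:~R).
  rewrite {1}ES' ES {1}ET' ET.
  transitivity (orient O A C * dot B A C + orient A B C * dot O A C); first by ring.
  transitivity (- (orient O A B * dot C O B + orient O B C * dot A O B)); last by ring.
  by rewrite /orient /dot; ring.
have scd : dist O A + dist A B = dist B C + dist C O := sums.
have [N [[S0 T0] [gE g'E hE h'E] [N2 gN] [SN TN] [Es Ef]]] :=
  excircle_relations a0 b0 d0 erefl scd OAC OAB g2 g'2 h2 h'2 gs hs gh.
have s0 : 0 < dist O A + dist A B by rewrite addr_gt0.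
have g0 : 0 < orient O A C.
  rewrite gE; apply: addr_gt0; [apply: mulr_gt0 | apply: divr_gt0] => //.
  by rewrite mulr_gt0 ?subr_gt0.

have [h0 h'0] := side_triangles quad lab g0.
have dN : delta O A B C * Num.sqrt (dist O A * dist A B * dist B C * dist C O
    - 4 * (dist O A + dist A B) ^+ 2) = N.
  apply: (delta_sqrt s0 g0 _ N2); rewrite -gN.
  by rewrite {2}ES {1}ES'; ring.
exists S, T; split.
- rewrite /Sigma -[2 * delta O A B C * _]mulrA dN mulrA SN mulfK //.
  by rewrite gt_eqF // ltr_pwDl ?sqr_ge0 // ltr0n.
- rewrite /Tau -[2 * delta O A B C * _]mulrA dN mulrA TN mulfK //.
  rewrite gt_eqF //; apply: ltr_pwDl.
    by apply: mulr_gt0 => //; apply: exprn_gt0.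
  by rewrite mulr_ge0 ?sqr_ge0.
set e := dist O A - dist B C in gE g'E hE h'E Es Ef.
set f := dist O A - dist C O in hE h'E Ef.
set s := dist O A + dist A B in s0 gE g'E hE h'E Es Ef.
have e0 : 0 < e by rewrite subr_gt0.
have D0 : 0 < T%:~R - S%:~R :> R.
  have : 0 < 8 * s ^+ 2 * (T%:~R - S%:~R).
    by rewrite Es !mulr_gt0 // exprn_gt0.
  by rewrite pmulr_rgt0 // mulr_gt0 // exprn_gt0.
(* Positivity of [orient O A B] and [orient O B C] says T e |f| < 8 s^2; [Es] converts this into the
   bounds on [f]. *)
have bound (x : R) : T%:~R * e * x < 8 * s ^+ 2 -> (T%:~R - S%:~R) * x < e * S%:~R.
  move=> H; have Te : 0 < T%:~R * e by rewrite mulr_gt0.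
  rewrite -(ltr_pM2l Te).
  have -> : T%:~R * e * (e * S%:~R) = 8 * s ^+ 2 * (T%:~R - S%:~R).
    by rewrite Es; ring.
  by rewrite mulrCA [ltRHS]mulrC ltr_pM2l.
have f1 : (T%:~R - S%:~R) * f < e * S%:~R.
  apply: bound; have := mulr_gt0 h0 s0; rewrite hE.
  by move: (T%:~R * e * f) (s ^+ 2) => u v; clear -u v; lra.
have f2 : - (T%:~R - S%:~R) * f < e * S%:~R.
  rewrite mulNr -mulrN; apply: bound; have := mulr_gt0 h'0 s0; rewrite h'E mulrN.
  by move: (T%:~R * e * f) (s ^+ 2) => u v; clear -u v; lra.
have Ee : e = (za - zc)%:~R by rewrite /e rmorphB Ea Ec.
have Ef' : f = (za - zd)%:~R by rewrite /f rmorphB Ea Ed.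
have Es' : s = (za + zb)%:~R by rewrite /s rmorphD Ea Eb.
move: (za - zc) (za - zd) (za + zb) Ee Ef' Es' => ei fi si Ee Ef' Es'.
apply: (@classification_int S T ei fi si).
- by rewrite -(ltr0z R).
- by rewrite -(ltr0z R).
- by rewrite -(ltr0z R) -Ee.
- by rewrite -(ltr0z R) -Es'.
- rewrite -(intr_eq0 R) -Ef' subr_eq0; apply: contra_notN hkite => /eqP ad.
  apply: kite_of_sides => //; apply: (@addrI _ (dist C O)).
  by rewrite -{1}ad sums addrC.
- by apply: (@intr_inj R); rewrite !(rmorphM, rmorphB, rmorphXn) /= -Ee -Es'.
- by apply: (@intr_inj R); rewrite !(rmorphM, rmorphB, rmorphXn) /= -Ee -Ef'.
- by rewrite -(ltr_int R) !(rmorphM, rmorphB) /= -Ee -Ef'.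
- by rewrite -(ltr_int R) !(rmorphM, rmorphN, rmorphB) /= -Ee -Ef'.
(* If x y = 64 then S D = 8 T, hence 8 s = S e, and [orient A B C] = 2 s - S e / 4 vanishes. *)
apply: contraNneq ABC => /(congr1 (fun z : int => z%:~R : R)).
rewrite !(rmorphM, rmorphB) /= => xy64'.
have {xy64'} xy64 : (S%:~R - 8) * (T%:~R - S%:~R - 8) = 64 :> R := xy64'.
rewrite g'E subr_eq0; apply/eqP.
have SD : S%:~R * (T%:~R - S%:~R) = 8 * T%:~R :> R.
  transitivity ((S%:~R - 8) * (T%:~R - S%:~R - 8) + 8 * T%:~R - 64 :> R).
    by ring.
  by rewrite xy64; ring.
have E : 8 * s = S%:~R * e.
  apply/eqP; rewrite -(@eqrXn2 _ 2) ?mulr_ge0 ?ltW //; apply/eqP.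
  apply: (mulIf (lt0r_neq0 D0)).
  transitivity (8 * (8 * s ^+ 2 * (T%:~R - S%:~R))); first by ring.
  rewrite Es; transitivity (e ^+ 2 * S%:~R * (8 * T%:~R)); first by ring.
  by rewrite -SD; ring.
by rewrite -E; field.
Qed.
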